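(* Let $\Theta$, $\mathcal X$, $\mathcal S$ be finite sets, let $\{P_\theta:\theta\in\Theta\}$ be a family of probability distributions on $\mathcal X$, let $T:\mathcal X\to\mathcal S$ be a statistic, let $Q_\theta$ be the distribution of $T(X)$ when $X\sim P_\theta$, and let $\pi$ be a prior on $\Theta$ with $\pi(\theta)>0$ for every $\theta\in\Theta$. Then the following statements are equivalent. (i) $T$ is Bayes-risk preserving at $\pi$. (ii) There exists a Markov kernel $K(x\mid s)$ from $\mathcal S$ to $\mathcal X$, independent of $\theta$, such that $$P_\theta(x)=\sum_{s\in\mathcal S}Q_\theta(s)K(x\mid s)\qquad\text{for all }\theta\in\Theta,\ x\in\mathcal X.$$ (iii) $T$ is sufficient for $\{P_\theta:\theta\in\Theta\}$.
   Context: A Markov kernel from a finite set $\mathcal Y$ to a finite set $\mathcal Z$ is a function $\kappa(z\mid y)\ge 0$ with $\sum_{z\in\mathcal Z}\kappa(z\mid y)=1$ for every $y\in\mathcal Y$. A finite decision problem consists of a finite action set $\mathcal A$ and a loss function $L:\Theta\times\mathcal A\to[0,\infty)$. A randomized decision rule based on $X$ is a Markov kernel $\delta(a\mid x)$ from $\mathcal X$ to $\mathcal A$; a rule based on $T$ is a Markov kernel $\gamma(a\mid s)$ from $\mathcal S$ to $\mathcal A$. The corresponding Bayes risks are $$R_X(\pi,L)=\inf_\delta\sum_{\theta,x,a}\pi(\theta)P_\theta(x)\delta(a\mid x)L(\theta,a),\qquad R_T(\pi,L)=\inf_\gamma\sum_{\theta,s,a}\pi(\theta)Q_\theta(s)\gamma(a\mid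 s)L(\theta,a),$$ where the infima are over all randomized decision rules based on $X$, respectively on $T$. The statistic $T$ is Bayes-risk preserving at $\pi$ if $R_X(\pi,L)=R_T(\pi,L)$ for every finite action set $\mathcal A$ and every loss function $L:\Theta\times\mathcal A\to[0,\infty)$. The statistic $T$ is sufficient for $\{P_\theta:\theta\in\Theta\}$ if the conditional distribution of $X$ given $T=s$ can be chosen independently of $\theta$ for every $s$ having positive probability under at least one $P_\theta$; that is, for each such $s$ there is a single probability distribution on $\mathcal X$ that equals $P_\theta(X\in\cdot\mid T(X)=s)$ for every $\theta$ with $Q_\theta(s)>0$. *)

(* Defs.v *)
From HB Require Import structures.
From mathcomp Require Import all_boot all_order all_algebra.
From mathcomp Require Import all_classical all_reals.

Set Implicit Arguments.
Unset Strict Implicit.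
Unset Printing Implicit Defensive.

Import Order.TTheory GRing.Theory Num.Theory.

Local Open Scope classical_set_scope.
Local Open Scope ring_scope.

Definition is_distr (R : realType) (Y : finType) (p : Y -> R) : Prop :=
  (forall y, 0 <= p y) /\ \sum_y p y = 1.

(* k y z stands for k(z | y). *)
Definition is_kernel (R : realType) (Y Z : finType) (k : Y -> Z -> R) : Prop :=
  forall y, is_distr (k y).

Definition pr (R : realType) (Y : finType) (p : Y -> R) (E : {set Y}) : R :=
  \sum_(y in E) p y.

(* Only meaningful when pr p F != 0 (division by zero returns 0). *)
Definition cond_pr (R : realType) (Y : finType) (p : Y -> R)
    (E F : {set Y}) : R :=
  pr p (E :&: F) / pr p F.

Definition fiber (X S : finType) (T : X -> S) (s : S) : {set X} :=
  [set x | T x == s]%SET.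

Definition stat_law (R : realType) (Theta X S : finType)
    (P : Theta -> X -> R) (T : X -> S) (theta : Theta) (s : S) : R :=
  pr (P theta) (fiber T s).

Definition risk (R : realType) (Theta Y A : finType) (pi : Theta -> R)
    (P : Theta -> Y -> R) (L : Theta -> A -> R) (delta : Y -> A -> R) : R :=
  \sum_theta \sum_y \sum_a pi theta * P theta y * delta y a * L theta a.

(* When there is a rule at all, the infimum is over a nonempty set bounded
   below by 0 as soon as L >= 0. If A is empty and Y is not, there is no rule
   and inf returns 0 instead of +oo; this happens simultaneously for the rules
   based on X and on T, so it does not affect equality of the two risks. *)
Definition bayes_risk (R : realType) (Theta Y A : finType) (pi : Theta -> R)
    (P : Theta -> Y -> R) (L : Theta -> A -> R) : R :=
  inf [set risk pi P L delta | delta in [set d : Y -> A -> R | is_kernel d]].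

Definition bayes_risk_preserving (R : realType) (Theta X S : finType)
    (P : Theta -> X -> R) (T : X -> S) (pi : Theta -> R) : Prop :=
  forall (A : finType) (L : Theta -> A -> R),
    (forall theta a, 0 <= L theta a) ->
    bayes_risk pi P L = bayes_risk pi (stat_law P T) L.

Definition sufficient (R : realType) (Theta X S : finType)
    (P : Theta -> X -> R) (T : X -> S) : Prop :=
  forall s : S, (exists theta, 0 < stat_law P T theta s) ->
    exists mu : X -> R, is_distr mu /\
      forall theta, 0 < stat_law P T theta s ->
        forall E : {set X}, pr mu E = cond_pr (P theta) E (fiber T s).

(* Main.v *)
Require Import Defs.
From HB Require Import structures.
From mathcomp Require Import all_boot all_order all_algebra.
From mathcomp Require Import all_classical all_reals.

(** The proof goes round the cycle (i) -> (iii) -> (ii) -> (i).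

    (ii) -> (i).  Call an experiment P' a garbling of P when P' is the image of
    P under a Markov kernel.  Composing rules with the kernel shows that every
    risk attainable from a garbling is attainable from the original experiment
    ([risk_garbling]).  The law of T is always a (deterministic) garbling of P,
    and (ii) says that P is a garbling of the law of T, so the two sets of
    attainable risks coincide, and hence so do their infima.

    (i) -> (iii).  Well-chosen problems with two actions already force
    sufficiency.  A Bayes rule minimizes the posterior
    loss pointwise, so with two actions the Bayes risk based on X is
    \sum_x min (a x) (b x), whereas the one based on T takes the minimum after
    summing a and b over each fiber.  The latter is at least the former in
    every fiber, so equality of the Bayes risks forces equality in every fiber.
    Fix s and two parameters t1, t2, and choose the losses so that
    a x = P_t1(x) Q_t2(s) and b x = P_t2(x) Q_t1(s).  Over the fiber of s both
    sum to Q_t1(s) Q_t2(s), and the equality case of the superadditivity of min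
    then gives a = b on the fiber ([bayes_risk_preserving_cross]).  This
    cross-product identity says that the conditional laws given T = s under t1
    and t2 agree.

    (iii) -> (ii).  The common conditional laws of X given T = s, completed
    arbitrarily at the values s of probability zero, form the kernel. *)

Set Implicit Arguments.
Unset Strict Implicit.
Unset Printing Implicit Defensive.

Import Order.TTheory GRing.Theory Num.Theory.

Local Open Scope ring_scope.

(** * Markov kernels *)

Section Kernels.
Variable R : realType.

Definition kernel_comp (Y Z A : finType) (K : Y -> Z -> R) (d : Z -> A -> R) :
  Y -> A -> R := fun y a => \sum_z K y z * d z a.

Lemma is_kernel_comp (Y Z A : finType) (K : Y -> Z -> R) (d : Z -> A -> R) :
  is_kernel K -> is_kernel d -> is_kernel (kernel_comp K d).
Proof.
move=> hK hd y; split=> [a|].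
  by apply: sumr_ge0 => z _; rewrite mulr_ge0 ?(hK y).1 ?(hd z).1.
rewrite /kernel_comp exchange_big /= -(hK y).2.
by apply: eq_bigr => z _; rewrite -mulr_sumr (hd z).2 mulr1.
Qed.

Definition det_kernel (Y Z : finType) (f : Y -> Z) : Y -> Z -> R :=
  fun y z => (f y == z)%:R.

Lemma is_kernel_det (Y Z : finType) (f : Y -> Z) : is_kernel (det_kernel f).
Proof.
move=> y; split=> [z|]; first exact: ler0n.
rewrite (bigD1 (f y)) //= {1}/det_kernel eqxx big1 ?addr0 // => z.
by rewrite /det_kernel eq_sym => /negbTE->.
Qed.

Lemma sum_det_kernel (Y Z : finType) (f : Y -> Z) (g : Z -> R) y :
  \sum_z det_kernel f y z * g z = g (f y).
Proof.
rewrite (bigD1 (f y)) //= {1}/det_kernel eqxx mul1r big1 ?addr0 // => z.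
by rewrite /det_kernel eq_sym => /negbTE->; rewrite mul0r.
Qed.

End Kernels.

(** * Bayes risks and garblings *)

Section BayesRisk.
Variables (R : realType) (Theta : finType) (pi : Theta -> R).

(** Observing z drawn from K y and then acting by d is the same as acting by
    the randomized rule [kernel_comp K d] on y itself. *)
Lemma risk_garbling (Y Z A : finType) (P : Theta -> Y -> R)
    (P' : Theta -> Z -> R) (K : Y -> Z -> R) (L : Theta -> A -> R) d :
    (forall t z, P' t z = \sum_y P t y * K y z) ->
  risk pi P' L d = risk pi P L (kernel_comp K d).
Proof.
move=> P'E; rewrite /risk; apply: eq_bigr => t _.
transitivity (\sum_z \sum_y \sum_a pi t * P t y * (K y z * d z a) * L t a).
  apply: eq_bigr => z _; rewrite exchange_big /=; apply: eq_bigr => a _.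
  rewrite P'E mulr_sumr !mulr_suml; apply: eq_bigr => y _.
  by rewrite !mulrA.
rewrite exchange_big; apply: eq_bigr => y _ /=.
rewrite exchange_big; apply: eq_bigr => a _ /=.
by rewrite mulr_sumr mulr_suml.
Qed.

(** Comparing the sets of attainable risks rather than their infima makes this
    hold for every action set, including an empty one. *)
Lemma bayes_risk_equiv (Y Z A : finType) (P : Theta -> Y -> R)
    (P' : Theta -> Z -> R) (K : Y -> Z -> R) (K' : Z -> Y -> R)
    (L : Theta -> A -> R) :
    is_kernel K -> is_kernel K' ->
    (forall t z, P' t z = \sum_y P t y * K y z) ->
    (forall t y, P t y = \sum_z P' t z * K' z y) ->
  bayes_risk pi P L = bayes_risk pi P' L.
Proof.
move=> hK hK' P'E PE; rewrite /bayes_risk; congr inf.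
apply/seteqP; split=> _ [d hd <-].
  by exists (kernel_comp K' d); rewrite -?(risk_garbling _ _ PE) //=;
    apply: is_kernel_comp.
by exists (kernel_comp K d); rewrite -?(risk_garbling _ _ P'E) //=;
  apply: is_kernel_comp.
Qed.

(** The posterior expected loss of the action a, up to the normalizing factor
    (the marginal probability of y). *)
Definition posterior_loss (Y A : finType) (P : Theta -> Y -> R)
  (L : Theta -> A -> R) y a : R := \sum_t pi t * P t y * L t a.

Lemma risk_posterior (Y A : finType) (P : Theta -> Y -> R)
    (L : Theta -> A -> R) d :
  risk pi P L d = \sum_y \sum_a d y a * posterior_loss P L y a.
Proof.
rewrite /risk exchange_big; apply: eq_bigr => y _ /=.
rewrite exchange_big; apply: eq_bigr => a _ /=.
by rewrite mulr_sumr; apply: eq_bigr => t _; rewrite mulrAC mulrC.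
Qed.

(** A convex combination of posterior losses is at least the smallest one, so
    the nonrandomized rule f attains the infimum. *)
Lemma bayes_risk_argmin (Y A : finType) (P : Theta -> Y -> R)
    (L : Theta -> A -> R) (f : Y -> A) :
    (forall y a, posterior_loss P L y (f y) <= posterior_loss P L y a) ->
  bayes_risk pi P L = \sum_y posterior_loss P L y (f y).
Proof.
move=> fmin; set m := RHS.
have lb_m : lbound [set risk pi P L d | d in [set d | is_kernel d]]%classic m.
  move=> _ [d hd <-]; rewrite risk_posterior; apply: ler_sum => y _.
  rewrite -[leLHS]mul1r -(hd y).2 mulr_suml; apply: ler_sum => a _.
  by rewrite ler_wpM2l ?(hd y).1.
have m_in : [set risk pi P L d | d in [set d | is_kernel d]]%classic m.
  exists (det_kernel R f); first exact: is_kernel_det.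
  by rewrite risk_posterior; apply: eq_bigr => y _; rewrite sum_det_kernel.
apply/le_anti/andP; split; first by apply: ge_inf => //; exists m.
by apply: lb_le_inf => //; exists m.
Qed.

Lemma bayes_risk_bool (Y : finType) (P : Theta -> Y -> R)
    (L : Theta -> bool -> R) :
  bayes_risk pi P L =
  \sum_y Num.min (posterior_loss P L y true) (posterior_loss P L y false).
Proof.
pose f y := posterior_loss P L y true <= posterior_loss P L y false.
rewrite (@bayes_risk_argmin _ _ _ _ f) => [|y a].
  by apply: eq_bigr => y _; rewrite /f; case: leP.
by case Ef: (f y); case: a => //; move: Ef; rewrite /f // => /negbT; rewrite -ltNge => /ltW.
Qed.

End BayesRisk.

(** * Superadditivity of the minimum and its equality case *)

Section SumMin.
Variables (R : realDomainType) (I : finType).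
Implicit Types (D : {pred I}) (a b : I -> R).

Lemma sum_min_le D a b :
  \sum_(i in D) Num.min (a i) (b i)
    <= Num.min (\sum_(i in D) a i) (\sum_(i in D) b i).
Proof.
by rewrite le_min; apply/andP; split; apply: ler_sum => i _;
  rewrite ge_min lexx ?orbT.
Qed.

Lemma ler_sum_eq D a b :
    (forall i, i \in D -> a i <= b i) ->
    \sum_(i in D) a i = \sum_(i in D) b i ->
  forall i, i \in D -> a i = b i.
Proof.
move=> ab eq_ab i Di.
have dge0 j : j \in D -> 0 <= b j - a j by move=> Dj; rewrite subr_ge0 ab.
have /eqP : \sum_(j in D) (b j - a j) = 0 by rewrite sumrB eq_ab subrr.
rewrite psumr_eq0 // => /allP/(_ i (mem_index_enum i)).
by rewrite Di subr_eq0 => /eqP.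
Qed.

(** The equality case of [sum_min_le]: a - min a b and b - min a b are both
    nonnegative with sum zero, hence vanish. *)
Lemma sum_min_eq D a b :
    \sum_(i in D) a i = \sum_(i in D) b i ->
    \sum_(i in D) Num.min (a i) (b i) = \sum_(i in D) a i ->
  forall i, i \in D -> a i = b i.
Proof.
move=> eq_ab min_a i Di.
rewrite -(ler_sum_eq _ min_a Di) => [|j _]; last by rewrite ge_min lexx.
apply: (@ler_sum_eq D (fun j => Num.min (a j) (b j)) b) => // [j _|].
  by rewrite ge_min lexx orbT.
by rewrite min_a.
Qed.

End SumMin.

(** * Experiments induced by a statistic *)

Section Statistic.
Variables (R : realType) (Theta X S : finType).
Variables (P : Theta -> X -> R) (T : X -> S) (pi : Theta -> R).
Hypothesis P_distr : forall t, is_distr (P t).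

Let Q := stat_law P T.

Lemma in_fiber x s : (x \in fiber T s) = (T x == s).
Proof. by rewrite inE. Qed.

Lemma sum_fibers (F : X -> R) :
  \sum_x F x = \sum_s \sum_(x in fiber T s) F x.
Proof.
rewrite (partition_big T xpredT) //=; apply: eq_bigr => s _.
by apply: eq_bigl => x; rewrite in_fiber.
Qed.

Lemma stat_law_det_kernel t s : Q t s = \sum_x P t x * det_kernel R T x s.
Proof.
rewrite /Q /stat_law /pr big_mkcond /=; apply: eq_bigr => x _.
by rewrite in_fiber /det_kernel; case: eqP; rewrite ?mulr1 ?mulr0.
Qed.

Lemma stat_law_ge0 t s : 0 <= Q t s.
Proof. by apply: sumr_ge0 => x _; rewrite (P_distr t).1. Qed.

Lemma stat_law_eq0 t x : Q t (T x) = 0 -> P t x = 0.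
Proof.
move=> /eqP; rewrite psumr_eq0 => [/allP/(_ x (mem_index_enum x))|y _].
  by rewrite in_fiber eqxx => /eqP.
by rewrite (P_distr t).1.
Qed.

Lemma posterior_loss_stat_law (A : finType) (L : Theta -> A -> R) s a :
  posterior_loss pi Q L s a = \sum_(x in fiber T s) posterior_loss pi P L x a.
Proof.
rewrite /posterior_loss exchange_big; apply: eq_bigr => t _ /=.
by rewrite -mulr_suml -mulr_sumr.
Qed.

(** Cross-multiplied form of the equality of the conditional laws under t1 and
    t2, so that it also makes sense where Q vanishes.  The loss depends on s and
    makes the two actions tie in the fiber of s. *)
Lemma bayes_risk_preserving_cross :
    (forall t, 0 < pi t) -> bayes_risk_preserving P T pi ->
  forall t1 t2 s x, x \in fiber T s -> P t1 x * Q t2 s = P t2 x * Q t1 s.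
Proof.
move=> pi_gt0 RX_eq_RT t1 t2 s.
(* Dividing by the prior cancels it from the posterior losses, which become
   exactly the two sides of the identity. *)
pose L t (c : bool) := if c then (t == t1)%:R * (Q t2 s / pi t)
                       else (t == t2)%:R * (Q t1 s / pi t).
have L_ge0 t c : 0 <= L t c.
  by case: c; rewrite mulr_ge0 ?divr_ge0 ?ler0n ?stat_law_ge0 // ltW.
have lossE u v x :
    \sum_t pi t * P t x * ((t == u)%:R * (Q v s / pi t)) = P u x * Q v s.
  rewrite (bigD1 u) //= eqxx mul1r big1 => [|t /negbTE->]; last first.
    by rewrite mul0r mulr0.
  by rewrite addr0 (mulrC (pi u)) -mulrA (mulrCA (pi u)) mulfV ?mulr1 ?gt_eqF.
pose a x := posterior_loss pi P L x true.
pose b x := posterior_loss pi P L x false.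
have aE x : a x = P t1 x * Q t2 s by exact: lossE.
have bE x : b x = P t2 x * Q t1 s by exact: lossE.
have fiber_min : \sum_(x in fiber T s) Num.min (a x) (b x)
    = Num.min (\sum_(x in fiber T s) a x) (\sum_(x in fiber T s) b x).
  apply: (@ler_sum_eq _ _ predT
    (fun s => \sum_(x in fiber T s) Num.min (a x) (b x))
    (fun s => Num.min (\sum_(x in fiber T s) a x)
                      (\sum_(x in fiber T s) b x))) => // [s' _|].
    exact: sum_min_le.
  have := RX_eq_RT bool L L_ge0; rewrite !bayes_risk_bool sum_fibers => ->.
  by apply: eq_bigr => s' _; rewrite !posterior_loss_stat_law.
have suma : \sum_(x in fiber T s) a x = Q t1 s * Q t2 s.
  by rewrite (eq_bigr _ (fun x _ => aE x)) -mulr_suml.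
have sumb : \sum_(x in fiber T s) b x = Q t1 s * Q t2 s.
  by rewrite (eq_bigr _ (fun x _ => bE x)) -mulr_suml mulrC.
move=> x xs; rewrite -aE -bE.
apply: (sum_min_eq _ _ xs); first by rewrite suma sumb.
by rewrite fiber_min suma sumb minxx.
Qed.

(** The common conditional law can be computed under any t0 giving s positive
    probability. *)
Lemma cross_sufficient :
    (forall t1 t2 s x, x \in fiber T s -> P t1 x * Q t2 s = P t2 x * Q t1 s) ->
  sufficient P T.
Proof.
move=> cross s [t0 Q0].
pose mu x := if x \in fiber T s then P t0 x / Q t0 s else 0.
have muE E : pr mu E = cond_pr (P t0) E (fiber T s).
  rewrite /cond_pr /pr mulr_suml /mu -big_mkcondr /=.
  by apply: eq_bigl => x; rewrite finset.in_setI.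
exists mu; split; first split.
- move=> x; rewrite /mu; case: ifP => // _.
  by rewrite divr_ge0 ?(P_distr t0).1 ?stat_law_ge0.
- by rewrite /mu -big_mkcond -mulr_suml mulfV ?gt_eqF.
move=> t Qt E; rewrite muE /cond_pr /pr !mulr_suml.
apply: eq_bigr => x; rewrite finset.in_setI => /andP[_ xs].
by apply/eqP; rewrite eqr_div ?lt0r_neq0 //; apply/eqP; exact: cross.
Qed.

(** Gluing the conditional laws: the mixture over s puts mass on x only at
    s = T x, because each conditional law is carried by its own fiber. *)
Lemma sufficient_kernel (nu : X -> R) : is_distr nu -> sufficient P T ->
  exists K : S -> X -> R, is_kernel K /\
    forall t x, P t x = \sum_s Q t s * K s x.
Proof.
move=> nu_distr suff.
have /choice[K hK] s : exists mu : X -> R, is_distr mu /\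
    forall t, 0 < Q t s ->
      forall E, pr mu E = cond_pr (P t) E (fiber T s).
  case: (pselect (exists t, 0 < Q t s)) => [/suff // | noQ].
  (* Where Q t s = 0 for every t, K s gets weight zero in every mixture. *)
  by exists nu; split=> // t Qt; case: noQ; exists t.
exists K; split=> [s|t x]; first exact: (hK s).1.
rewrite -(sum_det_kernel T (fun=> P t x) x); apply: eq_bigr => s _.
have [Qs0|Qs_neq0] := eqVneq (Q t s) 0.
  rewrite Qs0 mul0r /det_kernel; case: eqP => [Tx|_]; last by rewrite mul0r.
  by rewrite stat_law_eq0 ?mulr0 // Tx.
have Qs : 0 < Q t s by rewrite lt0r Qs_neq0 stat_law_ge0.
have := (hK s).2 t Qs [set x]%SET; rewrite {1}/pr big_set1 => ->.
rewrite /cond_pr mulrCA mulfV // mulr1 /pr /det_kernel -in_fiber.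
case: (boolP (x \in fiber T s)) => xs; rewrite ?mul1r ?mul0r.
  rewrite (big_pred1 x) // => y.
  by rewrite finset.in_setI finset.in_set1 /=; case: eqVneq => // ->.
rewrite big_pred0 // => y; rewrite finset.in_setI finset.in_set1.
by case: eqVneq => // ->; apply/negbTE.
Qed.

End Statistic.

(** * The equivalence *)

Theorem theorem1 (R : realType) (Theta X S : finType)
    (P : Theta -> X -> R) (P_distr : forall theta, is_distr (P theta))
    (T : X -> S)
    (pi : Theta -> R) (pi_distr : is_distr pi)
    (pi_pos : forall theta, 0 < pi theta) :
  (bayes_risk_preserving P T pi <->
     exists K : S -> X -> R, is_kernel K /\
       forall theta x, P theta x = \sum_s stat_law P T theta s * K s x) /\
  ((exists K : S -> X -> R, is_kernel K /\
       forall theta x, P theta x = \sum_s stat_law P T theta s * K s x) <->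
     sufficient P T).
Proof.
have [t0 _] : exists t0 : Theta, True.
  case: (pickP (@predT Theta)) => [t _|no_t]; first by exists t.
  by have := pi_distr.2; rewrite big_pred0 // => /esym/eqP; rewrite oner_eq0.
have suff_ker := sufficient_kernel P_distr (P_distr t0).
have bayes_suff : bayes_risk_preserving P T pi -> sufficient P T.
  by move=> /(bayes_risk_preserving_cross P_distr pi_pos); exact: cross_sufficient.
have ker_bayes : (exists K : S -> X -> R, is_kernel K /\
    forall t x, P t x = \sum_s stat_law P T t s * K s x) ->
    bayes_risk_preserving P T pi.
  move=> [K [hK PE]] A L _.
  exact: bayes_risk_equiv (is_kernel_det _ _) hK (stat_law_det_kernel P T) PE.
split; split; first by move=> /bayes_suff/suff_ker.
- exact: ker_bayes.
- by move=> /ker_bayes/bayes_suff.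
- exact: suff_ker.
Qed.
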